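(* Let $n\ge1$ and $r,s\ge0$ be integers. Put \[\pi''=\Big\{\lambda\in\Lambda^+(n,r+(n-1)s)\ \Big|\ \sum_{i\in R^+_\lambda}\lambda_i\le r+|R^+_\lambda|s\Big\},\qquad R^+_\lambda=\{1\le i\le n\mid\lambda_i>s\}.\] Then a bijective correspondence exists between the weights in $\pi''$ and the weights in $\pi=\Lambda^+(n,r,s)$.
   Context: $\Lambda^+(n,d)$ is the set of $\lambda\in\mathbb{Z}^n$ with $\lambda_1\ge\cdots\ge\lambda_n\ge0$ and $\sum_i\lambda_i=d$. $\Lambda(n,r,s)$ (the set of weights of the mixed tensor space $E^{\otimes r}\otimes(E^* )^{\otimes s}$, $E=K^n$ the natural $\mathrm{GL}(n)$-module) is the set of $\lambda\in\mathbb{Z}^n$ such that for some $0\le t\le\min\{r,s\}$ one has $\sum\{\lambda_i\mid\lambda_i>0\}=r-t$ and $\sum\{\lambda_i\mid\lambda_i<0\}=t-s$. $\Lambda^+(n,r,s)$ is the set of dominant weights $\lambda_1\ge\cdots\ge\lambda_n$ in $\Lambda(n,r,s)$. *)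

(* Defs.v *)
From HB Require Import structures.
From mathcomp Require Import all_boot all_order all_algebra.
From mathcomp Require Import classical_sets functions.

Set Implicit Arguments.
Unset Strict Implicit.
Unset Printing Implicit Defensive.

Import Order.TTheory GRing.Theory Num.Theory.
Local Open Scope ring_scope.

(* The weight lattice Z^n; coordinates are indexed by 0, ..., n-1. *)
Definition weight (n : nat) := {ffun 'I_n -> int}.

Definition dominant (n : nat) (lam : weight n) : Prop :=
  forall i j : 'I_n, (i <= j)%N -> lam j <= lam i.

(* Lambda^+(n, d) *)
Definition poly_weights (n d : nat) : set (weight n) :=
  [set lam | [/\ dominant lam, (forall i, 0 <= lam i)
               & \sum_i lam i = d%:Z]]%classic.

(* Lambda(n, r, s) *)
Definition mixed_weights (n r s : nat) : set (weight n) :=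
  [set lam | exists t : nat,
     [/\ (t <= minn r s)%N,
         \sum_(i | 0 < lam i) lam i = r%:Z - t%:Z
       & \sum_(i | lam i < 0) lam i = t%:Z - s%:Z]]%classic.

(* Lambda^+(n, r, s) *)
Definition dom_mixed_weights (n r s : nat) : set (weight n) :=
  [set lam | mixed_weights r s lam /\ dominant lam]%classic.

(* R^+_lam *)
Definition Rplus (n s : nat) (lam : weight n) : {set 'I_n} :=
  [set i : 'I_n | s%:Z < lam i]%SET.

(* pi''; it is only meant for n >= 1, where n.-1 is the true n - 1. *)
Definition pi_second (n r s : nat) : set (weight n) :=
  [set lam | poly_weights (r + n.-1 * s) lam /\
     \sum_(i in Rplus s lam) lam i <= r%:Z + (#|Rplus s lam| * s)%N%:Z]%classic.

(* Main.v *)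
Require Import Defs.
From HB Require Import structures.
From mathcomp Require Import all_boot all_order all_algebra.
From mathcomp Require Import zify.
From mathcomp Require Import classical_sets functions.

(** The bijection is translation by the constant weight (-s, ..., -s), i.e.
    tensoring with the (-s)-th power of the determinant.  For [lam] of degree
    [r + (n - 1) s], the translate [mu = lam - s] has total sum [r - s], and
    [lam] is polynomial exactly when every entry of [mu] is at least [- s].
    Since [Rplus s lam] indexes the positive entries of [mu], the inequality
    defining [pi_second] says that the positive part of [mu] sums to at most
    [r].

    It remains to recognise mixed weights intrinsically, without the existential
    parameter [t] ([mixed_weightsP]): they are the weights of total sum [r - s]
    whose positive part sums to at most [r].  Indeed [t] can only be the defect
    [r] minus the sum of the positive part; its bounds then express that
    the positive part is nonnegative and the negative part nonpositive.  The
    lower bound [- s] on the entries is automatic for mixed weights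
    ([mixed_weights_ge]), as the negative part sums to [t - s]. *)

Set Implicit Arguments.
Unset Strict Implicit.
Unset Printing Implicit Defensive.

Import Order.TTheory GRing.Theory Num.Theory.
Local Open Scope ring_scope.

Definition shift_weight (n : nat) (a : int) (lam : weight n) : weight n :=
  [ffun i => lam i + a].

Lemma shift_weightK (n : nat) (a : int) :
  cancel (@shift_weight n a) (shift_weight (- a)).
Proof. by move=> lam; apply/ffunP => i; rewrite !ffunE addrK. Qed.

Lemma shift_weightNK (n : nat) (a : int) :
  cancel (@shift_weight n (- a)) (shift_weight a).
Proof. by move=> lam; apply/ffunP => i; rewrite !ffunE subrK. Qed.

Lemma dominant_shift (n : nat) (a : int) (lam : weight n) :
  dominant (shift_weight a lam) <-> dominant lam.
Proof.
by split=> dom i j /dom; rewrite !ffunE lerD2r.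
Qed.

Lemma sum_shift (n : nat) (a : int) (lam : weight n) (A : {pred 'I_n}) :
  \sum_(i in A) shift_weight a lam i = \sum_(i in A) lam i + a *+ #|A|.
Proof.
under eq_bigr do rewrite ffunE.
by rewrite big_split sumr_const.
Qed.

Lemma sum_pos_neg (n : nat) (mu : weight n) :
  \sum_i mu i = \sum_(i | 0 < mu i) mu i + \sum_(i | mu i < 0) mu i.
Proof.
rewrite (bigID (fun i => 0 < mu i)) /=; congr (_ + _).
rewrite (bigID (fun i => mu i < 0)) /= [X in _ + X]big1 ?addr0; last first.
  by move=> i; rewrite -!leNgt => /andP[le0 ge0]; apply/le_anti/andP.
by apply: eq_bigl => i; case: ltgtP.
Qed.

Lemma sum_pos_ge0 (n : nat) (mu : weight n) : 0 <= \sum_(i | 0 < mu i) mu i.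
Proof. by apply: sumr_ge0 => i /ltW. Qed.

Lemma sum_neg_le0 (n : nat) (mu : weight n) : \sum_(i | mu i < 0) mu i <= 0.
Proof. by apply: sumr_le0 => i /ltW. Qed.

(** The parameter [t] is determined by the positive part, as its defect from
    [r]; the total sum then fixes the negative part. *)
Lemma mixed_weightsP (n r s : nat) (mu : weight n) :
  mixed_weights r s mu <->
  \sum_i mu i = r%:Z - s%:Z /\ \sum_(i | 0 < mu i) mu i <= r%:Z.
Proof.
rewrite sum_pos_neg.
have := sum_pos_ge0 mu; have := sum_neg_le0 mu.
rewrite /mixed_weights /=.
move: (\sum_(i | 0 < mu i) _) (\sum_(i | mu i < 0) _) => P N N_le0 P_ge0.
split=> [[t [t_le -> ->]] | [sumPN P_le]]; first by split; lia.
by exists `|r%:Z - P|%N; split; lia.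
Qed.

(** A single negative entry is bounded below by the whole negative part,
    which is [t - s] for some natural number [t]. *)
Lemma mixed_weights_ge (n r s : nat) (mu : weight n) (i : 'I_n) :
  mixed_weights r s mu -> - s%:Z <= mu i.
Proof.
case=> t [_ _ sumN]; have [mui_lt0|mui_ge0] := ltP (mu i) 0; last first.
  by apply: le_trans mui_ge0; rewrite oppr_le0.
have : \sum_(j | (mu j < 0) && (j != i)) mu j <= 0.
  by apply: sumr_le0 => j /andP[/ltW].
move: sumN; rewrite (bigD1 i) //=.
by move: (mu i) (\sum_(j | _) _) => a b; lia.
Qed.

Lemma sum_pos_shift (n s : nat) (lam : weight n) :
  \sum_(i | 0 < shift_weight (- s%:Z) lam i) shift_weight (- s%:Z) lam i
  = \sum_(i in Rplus s lam) lam i - (#|Rplus s lam| * s)%N%:Z.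
Proof.
rewrite (eq_bigl (mem (Rplus s lam))) => [|i]; last first.
  by rewrite /= inE ffunE subr_gt0.
by rewrite sum_shift mulNrn -mulr_natr natz -PoszM mulnC.
Qed.

(** The positivity of [n] makes [r + n.-1 * s] equal to [(r - s) + n * s],
    so that the two degree conditions agree. *)
Lemma pi_second_shiftP (n r s : nat) (lam : weight n) : (1 <= n)%N ->
  pi_second r s lam <-> dom_mixed_weights r s (shift_weight (- s%:Z) lam).
Proof.
move=> n_gt0.
have sumE : \sum_i shift_weight (- s%:Z) lam i = \sum_i lam i - (n * s)%N%:Z.
  by rewrite sum_shift card_ord mulNrn -mulr_natr natz -PoszM mulnC.
have degE : (r + n.-1 * s)%N%:Z - (n * s)%N%:Z = r%:Z - s%:Z.
  by case: n n_gt0 {lam sumE} => // n _; rewrite mulSn; lia.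
split.
- case=> [[dom _ sum_lam] pos_le]; split; last exact/dominant_shift.
  apply/mixed_weightsP; rewrite sumE sum_lam sum_pos_shift degE.
  by split=> //; lia.
- case=> mixed /dominant_shift dom.
  have lam_ge0 i : 0 <= lam i.
    by have := mixed_weights_ge i mixed; rewrite ffunE; lia.
  move/mixed_weightsP: mixed; rewrite sumE sum_pos_shift => -[sum_lam pos_le].
  by do ![split=> //]; lia.
Qed.

Theorem lemma1p5 (n r s : nat) (hn : (1 <= n)%N) :
  exists f : weight n -> weight n,
    set_bij (@pi_second n r s) (@dom_mixed_weights n r s) f.
Proof.
exists (shift_weight (- s%:Z)); split.
- by move=> lam /(pi_second_shiftP _ _ _ hn).
- by move=> lam mu _ _; apply: (can_inj (shift_weightNK _)).
- move=> mu mu_mixed; exists (shift_weight s%:Z mu); last exact: shift_weightK.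
  by apply/(pi_second_shiftP _ _ _ hn); rewrite shift_weightK.
Qed.
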